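(* Let $\mathcal{F}$ be a hereditary family of finite subsets of $\mathbb{N}$ covering $\mathbb{N}$. The following are equivalent: (i) $\mathcal{F}=\mathcal{E}^\perp$ for some hereditary family $\mathcal{E}$ of finite subsets of $\mathbb{N}$ covering $\mathbb{N}$. (ii) $\mathcal{F}=\mathcal{F}^{\perp\perp}$. (iii) $\mathcal{F}=\mathcal{C}(G)$ for some graph $G$ on $\mathbb{N}$.
   Context: A family is hereditary if it is closed under taking subsets of its members; it covers $\mathbb{N}$ if its union is $\mathbb{N}$. For such a family $\mathcal{F}$, $\mathcal{F}^\perp$ is the family of all finite $E\subseteq\mathbb{N}$ with $|E\cap F|\le 1$ for every $F\in\mathcal{F}$ (again hereditary and covering $\mathbb{N}$), and $\mathcal{F}^{\perp\perp}=(\mathcal{F}^\perp)^\perp$. Graphs are simple; $\mathcal{C}(G)$ is the family of all finite cliques of $G$ (finite sets of pairwise adjacent vertices, including $\emptyset$ and singletons). *)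

(* Defs.v *)
From mathcomp Require Import all_boot finmap.
From mathcomp Require Import boolp classical_sets.

Set Implicit Arguments.
Unset Strict Implicit.
Unset Printing Implicit Defensive.

Local Open Scope classical_set_scope.

Definition fset_family := set {fset nat}.

Definition hereditary (F : fset_family) : Prop :=
  forall A B : {fset nat}, F A -> (B `<=` A)%fset -> F B.

Definition covers (F : fset_family) : Prop :=
  \bigcup_(A in F) [set n : nat | n \in A] = [set: nat].

Definition perp (F : fset_family) : fset_family :=
  [set E : {fset nat} | forall A : {fset nat}, F A -> (#|` (E `&` A)%fset| <= 1)%N].

Record simple_graph := SimpleGraph {
  adj : nat -> nat -> Prop;
  adj_sym : forall x y, adj x y -> adj y x;
  adj_irrefl : forall x, ~ adj x x }.

Definition cliques (G : simple_graph) : fset_family :=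
  [set K : {fset nat} | forall x y, x \in K -> y \in K -> x <> y -> adj G x y].

(* Main.v *)
Require Import Defs.
From mathcomp Require Import all_boot finmap.
From mathcomp Require Import boolp classical_sets.

(** Membership in a [perp] only depends on pairs of points, so every [perp] is
    the clique family of the graph joining [x] and [y] when no member of the
    family contains both.  Conversely, a pair of distinct non-adjacent vertices
    lies in [perp (cliques G)], so a member of [perp (perp (cliques G))] cannot
    contain it. *)

Lemma cardfs_le1P (A : {fset nat}) :
  reflect (forall x y, x \in A -> y \in A -> x = y) (#|` A|%fset <= 1).
Proof.
apply: (iffP idP) => [A1 x y xA yA|Aeq].
  apply: contraTeq A1 => xy; rewrite -ltnNge.
  have <- : #|` [fset x; y]%fset| = 2 by rewrite cardfs2 xy.
  by apply/fsubset_leq_card/fsubsetP => z; rewrite !inE => /orP[] /eqP ->.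
have [->|[x xA]] := fset_0Vmem A; first by rewrite cardfs0.
rewrite -(cardfs1 x); apply/fsubset_leq_card/fsubsetP => y yA.
by rewrite inE; apply/eqP/Aeq.
Qed.

(** Trades the cardinality bound for a condition on pairs of points, the form that compares directly
    with cliques. *)
Lemma perpP (E : fset_family) (K : {fset nat}) :
  perp E K <-> forall A : {fset nat}, E A -> forall x y : nat,
    x \in K -> y \in K -> x \in A -> y \in A -> x = y.
Proof.
split=> [KE A EA x y xK yK xA yA|KE A EA].
  by apply: (cardfs_le1P _ (KE A EA)); rewrite inE ?xK ?yK.
apply/cardfs_le1P => x y; rewrite !inE => /andP[xK xA] /andP[yK yA].
exact: (KE A EA).
Qed.

Lemma hereditary_perp (E : fset_family) : hereditary (perp E).
Proof.
move=> A B /perpP AE /fsubsetP BA; apply/perpP => C EC x y /BA xA /BA yA.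
exact: (AE C EC).
Qed.

Lemma covers_perp (E : fset_family) : covers (perp E).
Proof.
rewrite /covers predeqE => n; split=> // _.
exists [fset n]%fset; last by rewrite /= inE.
by apply/perpP => A _ x y; rewrite !inE => /eqP -> /eqP ->.
Qed.

Lemma sub_perp_perp (E : fset_family) : (E `<=` perp (perp E))%classic.
Proof.
move=> A EA; apply/perpP => B /perpP BE x y xA yA xB yB.
exact: (BE A EA).
Qed.

Lemma perp_anti (E E' : fset_family) :
  (E `<=` E' -> perp E' `<=` perp E)%classic.
Proof. by move=> EE' K KE' A /EE' /KE'. Qed.

(** The usual Galois connection argument: reversing [sub_perp_perp] for [E] gives one inclusion, and
    [sub_perp_perp] for [perp E] is the other. *)
Lemma perp_perp_perp (E : fset_family) : perp (perp (perp E)) = perp E.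
Proof.
rewrite eqEsubset; split; last exact: sub_perp_perp.
exact/perp_anti/sub_perp_perp.
Qed.

Lemma perp_cliques (E : fset_family) : exists G, perp E = cliques G.
Proof.
(* Since [E] may fail to cover, a point in no member of [E] would get a loop without the conjunct
   [x <> y]. *)
pose e x y := x <> y /\ forall A : {fset nat}, E A -> x \in A -> y \notin A.
have e_sym x y : e x y -> e y x.
  move=> [xy eE]; split=> [/esym //|A EA yA].
  by apply: contraL yA => xA; exact: (eE A EA).
have e_irrefl x : ~ e x x by case.
exists (SimpleGraph e_sym e_irrefl); rewrite predeqE => K; split.
  move=> /perpP KE x y xK yK xy; split=> // A EA xA.
  by apply/negP => yA; apply: xy; exact: (KE A EA).
move=> KG; apply/perpP => A EA x y xK yK xA yA.
apply: contrapT => xy; have [_ /(_ A EA xA)] := KG x y xK yK xy.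
by rewrite yA.
Qed.

Lemma perp_perp_cliques (G : simple_graph) :
  perp (perp (cliques G)) = cliques G.
Proof.
rewrite eqEsubset; split; last exact: sub_perp_perp.
move=> K /perpP KG x y xK yK xy; apply: contrapT => nadj.
have xyP : perp (cliques G) [fset x; y]%fset.
  apply/perpP => A AG u v.
  (* In the two cases left, the clique [A] contains both [x] and [y], which forces the edge that
     [nadj] denies. *)
  rewrite !inE => /orP[] /eqP-> /orP[] /eqP-> // uA vA; exfalso; apply: nadj.
    exact: AG.
  by apply: AG.
by apply: xy; apply: (KG _ xyP) => //; rewrite !inE eqxx ?orbT.
Qed.

Theorem fact3p1 (F : fset_family) (hF : hereditary F) (cF : covers F) :
  [<-> exists E : fset_family, [/\ hereditary E, covers E & F = perp E];
       F = perp (perp F);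
       exists G : simple_graph, F = cliques G].
Proof.
split=> [[E [_ _ ->]]|]; first by rewrite perp_perp_perp.
split=> [->|[G FG]]; first exact: perp_cliques.
(* Clique families are fixed by the double perp, so [perp F] is a witness that closes the cycle. *)
exists (perp F); split; [exact: hereditary_perp|exact: covers_perp|].
by rewrite FG perp_perp_cliques.
Qed.
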